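(* The space $\mathcal{E}$ of (generalised) excursions, endowed with the excursion metric $d_{\mathcal{E}}$, is a separable metric space, and the set of continuous excursions is dense in it. Furthermore, the subspace $\mathcal{E}_b$ of bounded excursions (with the metric $d_{\mathcal{E}}$) is a Lusin space.
   Context: Excursions: $\mathcal{E}=\{h\colon[0,1]\to\mathbb{R}_+ : h(0)=0,\ h \text{ lower semi-continuous}\}$, where $\mathbb{R}_+=[0,\infty)$, and $\mathcal{E}_b$ is the subset of bounded functions in $\mathcal{E}$. A continuous excursion is an element of $\mathcal{E}$ that is a continuous function. Excursion metric: let $\lambda$ be Lebesgue measure on $[0,1]$. For $h,h'\in\mathcal{E}$ let $d_\lambda(h,h')=\inf\{\varepsilon>0 : \lambda(\{t : |h(t)-h'(t)|>\varepsilon\})<\varepsilon\}$, and $d_\Gamma(h,h')=d_H(\mathrm{epi}(h),\mathrm{epi}(h'))$, where $\mathrm{epi}(h)=\{(t,y)\in[0,1]\times\mathbb{R}_+ : y\ge h(t)\}$ and $d_H$ is the Hausdorff metric for closed subsets of $\mathbb{R}^2$. Then $d_{\mathcal{E}}=d_\Gamma+d_\lambda$. A metrisable topological space $X$ is a Lusin space if it is the continuous injective image of a Polish space, i.e. there exist a Polish space $Y$ and a continuous bijection $f\colon Y\to X$. *)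

(* Defs.v *)
From HB Require Import structures.
From mathcomp Require Import all_boot all_order all_algebra.
From mathcomp Require Import all_classical all_reals all_analysis.

Set Implicit Arguments.
Unset Strict Implicit.
Unset Printing Implicit Defensive.

Import Order.TTheory GRing.Theory Num.Theory.
Import numFieldNormedType.Exports.

Local Open Scope classical_set_scope.
Local Open Scope ring_scope.

Record metric_axioms (R : realType) (T : Type) (d : T -> T -> R) : Prop :=
  MetricAxioms {
    metric_xx : forall x, d x x = 0 ;
    metric_eq0 : forall x y, d x y = 0 -> x = y ;
    metric_symm : forall x y, d x y = d y x ;
    metric_tri : forall y x z, d x z <= d x y + d y z }.

(* The type T, equipped with the metric d and the topology it induces. *)
Definition metric_space (R : realType) (T : Type) (d : T -> T -> R)
  (hd : metric_axioms d) : Type := T.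

Section metric_space.
Context {R : realType} {T : choiceType} {d : T -> T -> R}.
Variable hd : metric_axioms d.

HB.instance Definition _ := Choice.copy (metric_space hd) T.
HB.instance Definition _ := isMetric.Build R (metric_space hd)
  (metric_xx hd) (metric_eq0 hd) (metric_symm hd) (metric_tri hd).

End metric_space.

(* The subspace metric; its topology is the library's topology on set_type. *)
Section sub_metric.
Context {R : realType} {X : metricType R} (A : set X).

Let sub_dist (x y : A) : R := mdist (\val x) (\val y).

Let sub_dist_ge0 x y : 0 <= sub_dist x y.
Proof. exact: mdist_ge0. Qed.

Let sub_dist_eq0 x y : sub_dist x y = 0 -> x = y.
Proof. by move=> /mdist_positivity /val_inj. Qed.

Let ball_sub_dist (x : A) e : ball x e = [set y | sub_dist x y < e].
Proof.
by rewrite -[LHS]/[set y : A | ball (\val x) e (\val y)] ballEmdist.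
Qed.

HB.instance Definition _ := @PseudoMetric_isMetric.Build R (set_type A)
  sub_dist sub_dist_ge0 sub_dist_eq0 ball_sub_dist.

End sub_metric.

#[short(type="completeMetricType")]
HB.structure Definition CompleteMetric (R : realType) :=
  { M of Metric R M & Complete M }.

Definition separable (T : topologicalType) : Prop :=
  exists2 S : set T, countable S & dense S.

(* A Polish space is presented as a separable complete metric space; only its
   topology matters. *)
Definition lusin (R : realType) (X : metricType R) : Prop :=
  exists Y : completeMetricType R,
    separable Y /\ exists2 f : Y -> X, continuous f & bijective f.

Definition euclid_dist (R : realType) (p q : R * R) : R :=
  Num.sqrt ((p.1 - q.1) ^+ 2 + (p.2 - q.2) ^+ 2).

Definition hausdorff_dist (R : realType) (A B : set (R * R)) : \bar R :=
  maxe (ereal_sup [set ereal_inf [set (euclid_dist a b)%:E | b in B] | a in A])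
       (ereal_sup [set ereal_inf [set (euclid_dist a b)%:E | a in A] | b in B]).

Section excursions.
Context {R : realType}.

Definition unit_itv : set R := `[0, 1].

Lemma zero_in_unit_itv : 0 \in unit_itv.
Proof. by rewrite inE /unit_itv /= in_itv /= lexx ler01. Qed.

Definition unit_itv0 : unit_itv := exist _ 0 zero_in_unit_itv.

Record excursion := Excursion {
  exc_fun :> unit_itv -> R ;
  exc_ge0 : forall t, 0 <= exc_fun t ;
  exc_at0 : exc_fun unit_itv0 = 0 ;
  exc_lsc : lower_semicontinuous (fun t => (exc_fun t)%:E) }.

HB.instance Definition _ := gen_eqMixin excursion.
HB.instance Definition _ := gen_choiceMixin excursion.

Implicit Types h : excursion.

(* The set under the infimum contains every e > 1. *)
Definition dist_lambda h h' : R :=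
  inf [set e : R | 0 < e /\
    (lebesgue_measure (set_val @` [set t | (e < `|h t - h' t|)%R]) < e%:E)%E].

Definition epi h : set (R * R) :=
  [set p | exists t : unit_itv, [/\ p.1 = \val t, 0 <= p.2 & h t <= p.2]].

Lemma hausdorff_dist_epi_fin_num h h' :
  hausdorff_dist (epi h) (epi h') \is a fin_num.
Proof.
have move0 (g : excursion) p : epi g p -> euclid_dist p (0, p.2) <= 1.
  case=> t [p1 _ _]; rewrite /euclid_dist /= subrr expr0n /= addr0 subr0.
  have := valP t; rewrite inE /unit_itv /= in_itv /= -p1 => /andP[t0 t1].
  by rewrite sqrtr_sqr ger0_norm.
have epi0 (g g' : excursion) p : epi g p -> epi g' (0, p.2).
  by case=> t [_ p2 _]; exists unit_itv0; rewrite exc_at0; split.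
have euclid_sym (p q : R * R) : euclid_dist p q = euclid_dist q p.
  by rewrite /euclid_dist -(sqrrN (p.1 - _)) -(sqrrN (p.2 - _)) !opprB.
have bound (g g' : excursion) :
    (0 <= ereal_sup [set ereal_inf [set (euclid_dist a b)%:E | b in epi g']
                    | a in epi g] <= 1)%E.
  apply/andP; split.
    apply: le_ereal_sup_tmp.
    exists (ereal_inf [set (euclid_dist (0, 0) b)%:E | b in epi g']).
      by exists (0, 0) => //; exists unit_itv0; rewrite exc_at0; split=> /=.
    by apply: le_ereal_inf_tmp => _ [b _ <-]; rewrite lee_fin sqrtr_ge0.
  apply: ge_ereal_sup => _ [p gp <-]; apply: ge_ereal_inf.
  exists (euclid_dist p (0, p.2))%:E; last by rewrite lee_fin (move0 g).
  by exists (0, p.2) => //; exact: (epi0 g).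
rewrite /hausdorff_dist.
under [X in maxe _ (ereal_sup X)]eq_imagel => b _.
  under eq_imagel => a _ do rewrite euclid_sym.
  over.
have /andP[l1 u1] := bound h h'; have /andP[l2 u2] := bound h' h.
rewrite ge0_fin_numE; last by rewrite le_max l1.
by apply: (@le_lt_trans _ _ 1%E); [rewrite ge_max u1 u2|rewrite ltry].
Qed.

Definition dist_Gamma h h' : R := fine (hausdorff_dist (epi h) (epi h')).

Definition exc_dist h h' : R := dist_Gamma h h' + dist_lambda h h'.

End excursions.
Arguments excursion : clear implicits.
Arguments unit_itv : clear implicits.

(* Main.v *)
Require Import Defs.
From HB Require Import structures.
From mathcomp Require Import all_boot all_order all_algebra.
From mathcomp Require Import all_classical all_reals all_analysis.
From mathcomp Require Import ring lra.

Set Implicit Arguments.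
Unset Strict Implicit.
Unset Printing Implicit Defensive.

Import Order.TTheory GRing.Theory Num.Theory.
Import numFieldNormedType.Exports.

Local Open Scope classical_set_scope.
Local Open Scope ring_scope.

(** Everything rests on the Lipschitz regularizations
    h_n(t) = inf_s (h(s) + n |t - s|) of an excursion h: h_n is the largest
    n-Lipschitz function below h, it is again an excursion, and h_n increases
    pointwise to h because h is lower semicontinuous ([lip_reg_cvg]).

    Density.  h_n tends to h in the excursion metric ([regularize_cvg]).  In
    measure this is monotone convergence.  For the epigraphs, h is bounded by
    some M on a finite net of the interval; a point of the epigraph of h_n at a
    height below M is within about M / n of the epigraph of h, and at heights
    above M the net points are used.  So the bounded Lipschitz excursions are
    dense.

    Lusin.  On bounded excursions put D(h, g) = d_E(h, g) + |sup h - sup g| and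
    rho(h, g) = sup_n D(h_n, g_n) ([height_dist] and [scale_dist]).  As D(h_n, h)
    tends to 0, rho dominates d_E, so the identity from (E_b, rho) to
    (E_b, d_E) is a continuous bijection.  It remains to see that rho is
    separable and complete.

    Completeness ([scale_dist_cauchy_limit]).  For n-Lipschitz functions the
    epigraph distance controls the uniform distance ([lipschitz_dist_Gamma]), so
    for a rho-Cauchy sequence x_k the regularizations (x_k)_n converge uniformly,
    for each n, to some phi_n.  The phi_n increase with n, and they are bounded
    because rho controls the suprema; f = sup_n phi_n is a bounded excursion.
    By compactness of the interval the regularizations of f are the phi_n
    ([lip_reg_le_monotone_limit]), and the supremum over n in rho turns the
    convergence at each n into convergence for rho.

    Separability ([separable_bounded_excursion]).  Code h by an n with D(h_n, h)
    small and by the rounded values of h_n on a grid finer than 1 / n.  If h and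
    g have the same code then h_n and g_n are uniformly close.  So are h_m and
    g_m for m <= n, since they are regularizations of h_n and g_n; for m > n, h_m
    lies between h_n and h, so D(h_m, h) <= D(h_n, h).  Hence rho(h, g) is small.
    The map to (E, d_E) is continuous with dense image, so E is separable too. *)

(** * Lipschitz regularization *)

Section lipschitz_regularization.
Context {R : realType}.
Implicit Types (u v : unit_itv R -> R) (n m : nat) (s t : unit_itv R).

(** The neighbourhoods of a point of the unit interval are read off its balls. *)
Lemma lower_semicontinuous_distP u :
  lower_semicontinuous (fun t => (u t)%:E) <->
  forall t a, a < u t ->
    exists2 d, 0 < d & forall s, `|\val t - \val s| < d -> a < u s.
Proof.
split=> [lsc t a at_|lsc t a].
  have [|V + VP] := lsc t a; first by rewrite lte_fin.
  move=> /nbhs_ballP[d /= d0 dV]; exists d => // s ts.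
  by rewrite -lte_fin; apply: VP; apply: dV.
rewrite lte_fin => /lsc[d d0 dP]; exists (ball t d); first exact: nbhsx_ballx.
by move=> s ts; rewrite lte_fin; apply: dP.
Qed.

Definition lipschitz n u := forall s t, u t <= u s + n%:R * `|\val t - \val s|.

Lemma lipschitz_le n m u : (n <= m)%N -> lipschitz n u -> lipschitz m u.
Proof.
move=> nm lu s t; apply: le_trans (lu s t) _.
by rewrite lerD2l ler_wpM2r// ler_nat.
Qed.

Lemma lipschitz_near n u t e : lipschitz n u -> 0 < e ->
  exists2 d, 0 < d & forall s, `|\val t - \val s| < d -> `|u t - u s| < e.
Proof.
move=> lu e0; have n0 : 0 < n%:R + 1 :> R by rewrite ltr_wpDl.
exists (e / (n%:R + 1)); first by rewrite divr_gt0.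
move=> s; rewrite ltr_pdivlMr// => ts.
have := lu s t; have := lu t s; rewrite (distrC (\val s)).
have := normr_ge0 (\val t - \val s); set x := `|_ - _| in ts *.
by rewrite ltr_norml => x0 h1 h2; apply/andP; split; lra.
Qed.

Lemma lipschitz_continuous n u : lipschitz n u -> continuous u.
Proof.
move=> lu t V /nbhs_ballP[e /= e0 eV].
have [d d0 dP] := lipschitz_near t lu e0.
by apply/nbhs_ballP; exists d => //= s ts; apply: eV; exact: dP.
Qed.

Lemma lipschitz_lower_semicontinuous n u :
  lipschitz n u -> lower_semicontinuous (fun t => (u t)%:E).
Proof.
move=> lu; apply/lower_semicontinuous_distP => t a at_.
have [|d d0 dP] := @lipschitz_near n u t (u t - a) lu; first by rewrite subr_gt0.
by exists d => // s /dP; rewrite ltr_norml => /andP[_]; lra.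
Qed.

(** The infimal convolution of u with the cone n |.|, also known as the
    Pasch-Hausdorff envelope. *)
Definition lip_reg n u t : R :=
  inf [set u s + n%:R * `|\val t - \val s| | s in [set: unit_itv R]].

Lemma le_lip_reg n u t y :
  (forall s, y <= u s + n%:R * `|\val t - \val s|) -> y <= lip_reg n u t.
Proof.
move=> yu; apply: lb_le_inf; last by move=> _ [s _ <-].
by eexists; exists t.
Qed.

Lemma lip_reg_le n u s t : (forall r, 0 <= u r) ->
  lip_reg n u t <= u s + n%:R * `|\val t - \val s|.
Proof.
move=> u0; apply: ge_inf; last by exists s.
by exists 0 => _ [r _ <-]; rewrite addr_ge0// mulr_ge0.
Qed.

Lemma lip_reg_ge0 n u t : (forall r, 0 <= u r) -> 0 <= lip_reg n u t.
Proof. by move=> u0; apply: le_lip_reg => s; rewrite addr_ge0// mulr_ge0. Qed.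

Lemma lip_reg_le_id n u t : (forall r, 0 <= u r) -> lip_reg n u t <= u t.
Proof.
by move=> u0; have := lip_reg_le n t t u0; rewrite subrr normr0 mulr0 addr0.
Qed.

Lemma lip_reg_near_inf n u t y : lip_reg n u t < y ->
  exists s, u s + n%:R * `|\val t - \val s| < y.
Proof.
move=> uy; apply: contrapT => /forallNP ny.
move: uy; apply/negP; rewrite -leNgt.
by apply: le_lip_reg => s; rewrite leNgt; apply/negP.
Qed.

Lemma lipschitz_lip_reg n u : (forall r, 0 <= u r) -> lipschitz n (lip_reg n u).
Proof.
move=> u0 s t; rewrite -lerBlDr; apply: le_lip_reg => r.
rewrite lerBlDr (le_trans (lip_reg_le n r t u0))// -addrA lerD2l -mulrDr.
by rewrite ler_wpM2l// [leRHS]addrC ler_distD.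
Qed.

Lemma lip_reg_maximal n u v :
  lipschitz n v -> (forall t, v t <= u t) -> forall t, v t <= lip_reg n u t.
Proof.
by move=> lv vu t; apply: le_lip_reg => s; rewrite (le_trans (lv s t))// lerD2r.
Qed.

(** Raising v by e raises every candidate value, hence the infimum, by e. *)
Lemma lip_reg_le_dist n u v e : (forall r, 0 <= u r) ->
  (forall t, u t <= v t + e) -> forall t, lip_reg n u t <= lip_reg n v t + e.
Proof.
move=> u0 uv t; rewrite -lerBlDr; apply: le_lip_reg => s.
by rewrite lerBlDr (le_trans (lip_reg_le n s t u0))// addrAC lerD2r.
Qed.

Lemma lip_reg_contraction n u v e : (forall r, 0 <= u r) -> (forall r, 0 <= v r) ->
  (forall t, `|u t - v t| <= e) ->
  forall t, `|lip_reg n u t - lip_reg n v t| <= e.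
Proof.
move=> u0 v0 uv t; rewrite ler_distl; apply/andP; split.
  rewrite lerBlDr; apply: lip_reg_le_dist => // s.
  by have := uv s; rewrite ler_distlC => /andP[_]; rewrite addrC.
apply: lip_reg_le_dist => // s.
by have := uv s; rewrite ler_distl => /andP[].
Qed.

Lemma lip_reg_homo n m u t : (forall r, 0 <= u r) -> (n <= m)%N ->
  lip_reg n u t <= lip_reg m u t.
Proof.
move=> u0 nm; apply: lip_reg_maximal => [|s]; last exact: lip_reg_le_id.
exact/(lipschitz_le nm)/lipschitz_lip_reg.
Qed.

(** By maximality the m-regularization lies between the n-regularization and u,
    so both have the same largest n-Lipschitz minorant. *)
Lemma lip_reg_lip_reg n m u t : (forall r, 0 <= u r) -> (n <= m)%N ->
  lip_reg n (lip_reg m u) t = lip_reg n u t.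
Proof.
move=> u0 nm; apply/eqP; rewrite eq_le; apply/andP; split.
  rewrite -[leRHS]addr0; apply: lip_reg_le_dist => s; first exact: lip_reg_ge0.
  by rewrite addr0; exact: lip_reg_le_id.
apply: lip_reg_maximal => [|s]; first exact: lipschitz_lip_reg.
exact: lip_reg_homo.
Qed.

(** Far from t the slope n lifts the candidate values above any bound, and near
    t lower semicontinuity keeps the values of u from dropping. *)
Lemma lip_reg_cvg u t a : (forall r, 0 <= u r) ->
  lower_semicontinuous (fun t => (u t)%:E) -> a < u t ->
  exists N, forall n, (N <= n)%N -> a <= lip_reg n u t.
Proof.
move=> u0 /lower_semicontinuous_distP/[apply] -[d d0 dP].
exists (Num.truncn (a / d)).+1 => n Nn.
apply: le_lip_reg => s; have [ts|ts] := ltP `|\val t - \val s| d.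
  by rewrite (le_trans (ltW (dP _ ts)))// lerDl mulr_ge0.
rewrite -[leLHS]add0r lerD//.
have : a / d < n%:R.
  by rewrite (lt_le_trans (truncnS_gt _))// ler_nat.
rewrite ltr_pdivrMr// => /ltW/le_trans; apply.
by rewrite ler_wpM2l.
Qed.

End lipschitz_regularization.

(** * The excursion metric *)

Section excursion_metric.
Context {R : realType}.
Implicit Types (h g k u v w : excursion R) (s t : unit_itv R) (p q : R * R).

Lemma excursion_eq h g : (forall t, h t = g t) -> h = g.
Proof.
case: h g => [f f0 f1 f2] [f' f'0 f'1 f'2] /= /funext ff'.
by subst f'; congr Excursion; exact: Prop_irrelevance.
Qed.

Lemma euclid_dist_sym p q : euclid_dist p q = euclid_dist q p.
Proof. by rewrite /euclid_dist -(sqrrN (p.1 - _)) -(sqrrN (p.2 - _)) !opprB. Qed.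

Lemma euclid_dist_vert (x y y' : R) : euclid_dist (x, y) (x, y') = `|y - y'|.
Proof. by rewrite /euclid_dist /= subrr expr0n /= add0r sqrtr_sqr. Qed.

Lemma dist1_le_euclid p q : `|p.1 - q.1| <= euclid_dist p q.
Proof. by rewrite -sqrtr_sqr ler_wsqrtr// lerDl sqr_ge0. Qed.

Lemma dist2_le_euclid p q : `|p.2 - q.2| <= euclid_dist p q.
Proof. by rewrite -sqrtr_sqr ler_wsqrtr// lerDr sqr_ge0. Qed.

Lemma euclid_le_dist p q : euclid_dist p q <= `|p.1 - q.1| + `|p.2 - q.2|.
Proof.
rewrite -[leRHS]ger0_norm ?addr_ge0// -[leRHS]sqrtr_sqr ler_wsqrtr//.
rewrite [leRHS]sqrrD !real_normK ?num_real//.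
by rewrite lerD2r lerDl mulrn_wge0// mulr_ge0.
Qed.

Lemma euclid_dist_triangle q p r :
  euclid_dist p r <= euclid_dist p q + euclid_dist q r.
Proof.
rewrite /euclid_dist; set a := p.1 - q.1; set b := p.2 - q.2.
set c := q.1 - r.1; set d := q.2 - r.2.
have -> : p.1 - r.1 = a + c by rewrite /a /c; ring.
have -> : p.2 - r.2 = b + d by rewrite /b /d; ring.
set x := Num.sqrt (a ^+ 2 + _); set y := Num.sqrt (c ^+ 2 + _).
have x0 : 0 <= x by exact: sqrtr_ge0.
have y0 : 0 <= y by exact: sqrtr_ge0.
have xE : x ^+ 2 = a ^+ 2 + b ^+ 2 by rewrite sqr_sqrtr// addr_ge0// sqr_ge0.
have yE : y ^+ 2 = c ^+ 2 + d ^+ 2 by rewrite sqr_sqrtr// addr_ge0// sqr_ge0.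
rewrite -[leRHS]ger0_norm ?addr_ge0// -[leRHS]sqrtr_sqr ler_wsqrtr//.
(* the Cauchy-Schwarz inequality *)
suff : a * c + b * d <= x * y by move=> ?; rewrite [leRHS]sqrrD xE yE; nra.
have xy0 : 0 <= x * y by exact: mulr_ge0.
rewrite (le_trans (ler_norm _))// -(ger0_norm xy0) -ler_sqr ?nnegrE//.
rewrite !real_normK ?num_real// exprMn xE yE.
have := sqr_ge0 (a * d - b * c); nra.
Qed.

Lemma dist_Gamma_sym h g : dist_Gamma h g = dist_Gamma g h.
Proof.
rewrite /dist_Gamma /hausdorff_dist maxC; congr fine; congr maxe.
  by congr ereal_sup; apply: eq_imagel => p _; congr ereal_inf;
    apply: eq_imagel => q _; rewrite euclid_dist_sym.
by congr ereal_sup; apply: eq_imagel => p _; congr ereal_inf;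
  apply: eq_imagel => q _; rewrite euclid_dist_sym.
Qed.

Lemma dist_Gamma_lt h g e p : dist_Gamma h g < e -> epi h p ->
  exists2 q, epi g q & euclid_dist p q < e.
Proof.
rewrite -lte_fin /dist_Gamma fineK ?hausdorff_dist_epi_fin_num//.
rewrite /hausdorff_dist gt_max => /andP[+ _] hp => he.
have : (ereal_inf [set (euclid_dist p q)%:E | q in epi g] < e%:E)%E.
  by apply: le_lt_trans he; apply: ereal_sup_ubound; exists p.
move/ereal_inf_lt => [_ [q gq <-]]; rewrite lte_fin.
by exists q.
Qed.

Lemma dist_Gamma_le h g e :
  (forall p, epi h p -> exists2 q, epi g q & euclid_dist p q <= e) ->
  (forall p, epi g p -> exists2 q, epi h q & euclid_dist p q <= e) ->
  dist_Gamma h g <= e.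
Proof.
move=> hg gh; rewrite -lee_fin /dist_Gamma fineK ?hausdorff_dist_epi_fin_num//.
rewrite /hausdorff_dist ge_max; apply/andP; split.
  apply: ge_ereal_sup => _ [p hp <-]; have [q gq pq] := hg p hp.
  by apply: ge_ereal_inf; exists (euclid_dist p q)%:E; [exists q|].
apply: ge_ereal_sup => _ [p hp <-]; have [q gq pq] := gh p hp.
apply: ge_ereal_inf; exists (euclid_dist q p)%:E; first by exists q.
by rewrite euclid_dist_sym.
Qed.

Lemma epi_exc h t : epi h (\val t, h t).
Proof. by exists t; split => //=; exact: exc_ge0. Qed.

Lemma dist_Gamma_ge0 h g : 0 <= dist_Gamma h g.
Proof.
rewrite leNgt; apply/negP => hg.
have [q _] := dist_Gamma_lt hg (epi_exc h unit_itv0).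
by apply/negP; rewrite -leNgt sqrtr_ge0.
Qed.

Lemma dist_Gamma_triangle g h k :
  dist_Gamma h k <= dist_Gamma h g + dist_Gamma g k.
Proof.
have half u v w e : 0 < e -> forall p, epi u p -> exists2 q, epi w q &
    euclid_dist p q <= dist_Gamma u v + dist_Gamma v w + e.
  move=> e0 p up.
  have [|q vq pq] := @dist_Gamma_lt u v (dist_Gamma u v + e / 2) p _ up.
    by rewrite ltrDl divr_gt0.
  have [|r wr qr] := @dist_Gamma_lt v w (dist_Gamma v w + e / 2) q _ vq.
    by rewrite ltrDl divr_gt0.
  exists r => //; rewrite (le_trans (euclid_dist_triangle q _ _))//.
  by rewrite (le_trans (lerD (ltW pq) (ltW qr)))// {3}[e]splitr addrACA.
apply/ler_addgt0Pr => e e0; apply: dist_Gamma_le; first exact: half.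
have -> : dist_Gamma h g + dist_Gamma g k = dist_Gamma k g + dist_Gamma g h.
  by rewrite addrC (dist_Gamma_sym g k) (dist_Gamma_sym h g).
exact: half.
Qed.

(** Lower semicontinuity makes epigraphs closed: a point (t, h t) that is
    approached by points of the epigraph of g belongs to it. *)
Lemma dist_Gamma_eq0 h g : dist_Gamma h g = 0 -> h = g.
Proof.
have le u v : dist_Gamma u v = 0 -> forall t, v t <= u t.
  move=> uv t; rewrite leNgt; apply/negP => ut.
  have /lower_semicontinuous_distP lv := @exc_lsc _ v.
  have [|d d0 dP] := lv t ((u t + v t) / 2); first by rewrite midf_lt.
  have e0 : 0 < Num.min d ((v t - u t) / 2).
    by rewrite lt_min d0 divr_gt0// subr_gt0.
  rewrite -uv in e0; have [[_ y] [s /= [-> y0 vsy]]] := dist_Gamma_lt e0 (epi_exc u t).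
  rewrite lt_min => /andP[td yd].
  have := dP s (le_lt_trans (dist1_le_euclid _ _) td).
  have := le_lt_trans (dist2_le_euclid _ _) yd.
  by rewrite ltr_norml /= => /andP[]; lra.
move=> hg; apply: excursion_eq => t; apply/eqP.
by rewrite eq_le !le// dist_Gamma_sym.
Qed.

(** The three epigraphs are nested, so only points of the epigraph of v have to
    be moved, and these belong to the epigraph of u. *)
Lemma dist_Gamma_sandwich u v w : (forall t, u t <= v t) -> (forall t, v t <= w t) ->
  dist_Gamma v w <= dist_Gamma u w.
Proof.
move=> uv vw; apply/ler_addgt0Pr => e e0.
have uw0 : 0 <= dist_Gamma u w + e by rewrite addr_ge0 ?dist_Gamma_ge0// ltW.
apply: dist_Gamma_le => p [t [p1 p2 pt]].
  have [||q wq /ltW pq] := @dist_Gamma_lt u w (dist_Gamma u w + e) p.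
  - by rewrite ltrDl.
  - by exists t; split => //; exact: le_trans (uv t) pt.
  - by exists q.
exists p; first by exists t; split => //; exact: le_trans (vw t) pt.
by case: p {p1 p2 pt} => x y; rewrite euclid_dist_vert subrr normr0.
Qed.

Lemma dist_Gamma_le_sup h g e : (forall t, `|h t - g t| <= e) -> dist_Gamma h g <= e.
Proof.
move=> hg; have e0 : 0 <= e by apply: le_trans (hg unit_itv0).
have half u v : (forall t, `|u t - v t| <= e) ->
    forall p, epi u p -> exists2 q, epi v q & euclid_dist p q <= e.
  move=> uv [x y] [t /= [-> y0 uy]]; exists (\val t, y + e).
    exists t; split => //=; first exact: addr_ge0.
    by have := uv t; rewrite ler_distlC => /andP[_] /le_trans; apply; rewrite lerD2r.
  by rewrite euclid_dist_vert opprD addNKr normrN ger0_norm.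
by apply: dist_Gamma_le; apply: half => // t; rewrite distrC.
Qed.

(** An epigraph point near (t, h t) lies over some s near t, and moving from s
    back to t costs at most n times their distance.  Hence convergence of
    epigraphs is uniform convergence among n-Lipschitz excursions. *)
Lemma lipschitz_dist_Gamma n h g t : lipschitz n h -> lipschitz n g ->
  `|h t - g t| <= (1 + n%:R) * dist_Gamma h g.
Proof.
have half u v : lipschitz n v -> v t <= u t + (1 + n%:R) * dist_Gamma u v.
  move=> lv; apply/ler_addgt0Pr => e e0.
  have n0 : 0 < 1 + n%:R :> R by rewrite ltr_pwDl.
  pose d := dist_Gamma u v + e / (1 + n%:R).
  have [|[_ y] [s /= [-> y0 vy]] pq] := @dist_Gamma_lt u v d _ _ (epi_exc u t).
    by rewrite ltrDl divr_gt0.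
  rewrite -addrA; have -> : (1 + n%:R) * dist_Gamma u v + e = (1 + n%:R) * d.
    by rewrite /d mulrDr mulrCA divff ?mulr1// gt_eqF.
  rewrite (le_trans (lv s t))//.
  have /ltW := le_lt_trans (dist2_le_euclid _ _) pq; rewrite /= ler_distlC => /andP[_ yd].
  have /ltW td := le_lt_trans (dist1_le_euclid _ _) pq.
  rewrite mulrDl mul1r addrA lerD//; first exact: le_trans vy yd.
  by rewrite ler_wpM2l.
move=> lh lg; rewrite ler_distlC half// lerBlDr andbT dist_Gamma_sym.
exact: half.
Qed.

Local Notation deviation_set h g e :=
  (set_val @` [set t : unit_itv R | (e < `|h t - g t|)%R] : set R).

(** The Lebesgue measure of an arbitrary set is its outer measure, whose
    monotonicity and subadditivity are all that the metric axioms use. *)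
Lemma dist_lambda_le h g e :
  0 < e -> (lebesgue_measure (deviation_set h g e) < e%:E)%E -> dist_lambda h g <= e.
Proof. by move=> e0 he; apply: ge_inf => //; exists 0 => x [/ltW]. Qed.

Lemma dist_lambda_lt h g e : dist_lambda h g < e ->
  0 < e /\ (lebesgue_measure (deviation_set h g e) < e%:E)%E.
Proof.
move=> hg; have [|d [d0 hd] de] := inf_lt _ hg.
  exists 2; split=> //; apply: (@le_lt_trans _ _ (lebesgue_measure `[0%R, 1%R])).
    by apply: le_outer_measure => _ [t _ <-]; have := valP t; rewrite inE.
  by rewrite lebesgue_measure_itv /= lte_fin ltr01 oppr0 adde0 lte_fin ltr1n.
split; first exact: lt_trans d0 de.
apply: (@le_lt_trans _ _ (lebesgue_measure (deviation_set h g d))); last first.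
  by apply: lt_trans hd _; rewrite lte_fin.
by apply: le_outer_measure; apply: image_subset => t; exact: lt_trans.
Qed.

Lemma dist_lambda_ge0 h g : 0 <= dist_lambda h g.
Proof.
by rewrite leNgt; apply/negP => /dist_lambda_lt[]; rewrite ltxx.
Qed.

Lemma dist_lambda_le_ptws h g u v :
  (forall t, `|h t - g t| <= `|u t - v t|) -> dist_lambda h g <= dist_lambda u v.
Proof.
move=> hu; apply/ler_addgt0Pr => e e0.
have [|d0 uvd] := @dist_lambda_lt u v (dist_lambda u v + e); first by rewrite ltrDl.
apply: dist_lambda_le => //; apply: le_lt_trans uvd.
apply: le_outer_measure; apply: image_subset => t /= /lt_le_trans; exact.
Qed.

Lemma dist_lambda_sym h g : dist_lambda h g = dist_lambda g h.
Proof.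
by apply/eqP; rewrite eq_le; apply/andP; split;
  apply: dist_lambda_le_ptws => t; rewrite distrC.
Qed.

Lemma dist_lambda_le_sup h g e :
  (forall t, `|h t - g t| <= e) -> dist_lambda h g <= e.
Proof.
move=> hg; have e0 : 0 <= e by apply: le_trans (hg unit_itv0).
apply/ler_addgt0Pr => d d0; have ed0 : 0 < e + d by rewrite ltr_wpDl.
apply: dist_lambda_le => //.
rewrite (_ : deviation_set _ _ _ = set0) ?measure0//.
apply/seteqP; split=> // _ [t /= + _].
by apply/negP; rewrite -leNgt (le_trans (hg t))// lerDl ltW.
Qed.

Lemma dist_lambda_triangle g h k :
  dist_lambda h k <= dist_lambda h g + dist_lambda g k.
Proof.
apply/ler_addgt0Pr => e e0; rewrite [e]splitr addrACA.
have [|d0 hd] := @dist_lambda_lt h g (dist_lambda h g + e / 2).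
  by rewrite ltrDl divr_gt0.
have [|d'0 hd'] := @dist_lambda_lt g k (dist_lambda g k + e / 2).
  by rewrite ltrDl divr_gt0.
move: (_ + _) d0 hd (_ + _) d'0 hd' => {e e0} a a0 ha b b0 hb.
apply: dist_lambda_le; first exact: addr_gt0.
apply: (@le_lt_trans _ _
  (lebesgue_measure (deviation_set h g a `|` deviation_set g k b))).
  apply: le_outer_measure => _ [t /= hkt <-].
  have [hgt|hgt] := ltP a `|h t - g t|; first by left; exists t.
  right; exists t => //=; rewrite -(ltrD2l a) (lt_le_trans hkt)//.
  by rewrite (le_trans (ler_distD (g t) _ _))// lerD2r.
apply: (le_lt_trans (outer_measureU2 _ _ _)).
by rewrite EFinD lteD.
Qed.

Lemma exc_dist_ge0 h g : 0 <= exc_dist h g.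
Proof. by rewrite addr_ge0 ?dist_Gamma_ge0 ?dist_lambda_ge0. Qed.

Lemma dist_Gamma_le_exc h g : dist_Gamma h g <= exc_dist h g.
Proof. by rewrite lerDl dist_lambda_ge0. Qed.

Lemma exc_dist_sym h g : exc_dist h g = exc_dist g h.
Proof. by rewrite /exc_dist dist_Gamma_sym dist_lambda_sym. Qed.

Lemma exc_dist_triangle g h k : exc_dist h k <= exc_dist h g + exc_dist g k.
Proof.
by rewrite addrACA lerD ?dist_Gamma_triangle ?dist_lambda_triangle.
Qed.

Lemma exc_dist_le_sup h g e : (forall t, `|h t - g t| <= e) -> exc_dist h g <= 2 * e.
Proof.
by move=> hg; rewrite mulr_natl mulr2n lerD ?dist_Gamma_le_sup ?dist_lambda_le_sup.
Qed.

Lemma exc_dist_sandwich u v w : (forall t, u t <= v t) -> (forall t, v t <= w t) ->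
  exc_dist v w <= exc_dist u w.
Proof.
move=> uv vw; rewrite lerD ?dist_Gamma_sandwich ?dist_lambda_le_ptws// => t.
by rewrite !ler0_norm ?lerN2 ?lerD2r ?subr_le0// (le_trans (uv t)).
Qed.

Lemma exc_dist_metric : metric_axioms (@exc_dist R).
Proof.
split.
- move=> h; apply/eqP; rewrite eq_le exc_dist_ge0 andbT -[leRHS](mulr0 2).
  by apply: exc_dist_le_sup => t; rewrite subrr normr0.
- move=> h g hg; apply: dist_Gamma_eq0; apply/eqP.
  by rewrite eq_le dist_Gamma_ge0 andbT -hg dist_Gamma_le_exc.
- exact: exc_dist_sym.
- exact: exc_dist_triangle.
Qed.

End excursion_metric.

(** * Convergence of the regularizations *)

Section grid.
Context {R : realType}.

Definition grid_point m k : unit_itv R := insubd unit_itv0 (k%:R / m.+1%:R).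

Lemma grid_point_near m (t : unit_itv R) : exists2 k, (k <= m.+1)%N &
  `|\val t - \val (grid_point m k)| <= m.+1%:R^-1.
Proof.
have /andP[t0 t1] : 0 <= \val t <= 1 by have := valP t; rewrite inE /unit_itv /= in_itv.
have m0 : 0 < m.+1%:R :> R by rewrite ltr0n.
have tm0 : 0 <= \val t * m.+1%:R by rewrite mulr_ge0.
pose k := Num.truncn (\val t * m.+1%:R).
have /andP[k1 k2] : k%:R <= \val t * m.+1%:R < k.+1%:R by exact: truncn_itv.
have km : k%:R <= m.+1%:R :> R by rewrite (le_trans k1)// ler_piMl.
exists k; first by rewrite ler_nat in km.
have -> : \val (grid_point m k) = k%:R / m.+1%:R.
  rewrite insubdK// inE /unit_itv /= in_itv /= divr_ge0//=.
  by rewrite ler_pdivrMr// mul1r.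
rewrite ger0_norm; last by rewrite subr_ge0 ler_pdivrMr.
rewrite lerBlDr -{1}[_^-1]mul1r -mulrDl ler_pdivlMr//.
by rewrite addrC natr1 ltW.
Qed.

End grid.

Section regularized_excursions.
Context {R : realType}.
Implicit Types (h g u v w : excursion R) (n m : nat) (s t : unit_itv R).

Lemma lip_reg_at0 n h : lip_reg n h unit_itv0 = 0.
Proof.
apply/eqP; rewrite eq_le lip_reg_ge0 ?andbT; last exact: exc_ge0.
by rewrite -[leRHS](exc_at0 h) lip_reg_le_id//; exact: exc_ge0.
Qed.

Definition regularize n h : excursion R :=
  @Excursion R (lip_reg n h) (fun t => lip_reg_ge0 n t (exc_ge0 h))
    (lip_reg_at0 n h)
    (lipschitz_lower_semicontinuous (lipschitz_lip_reg n (exc_ge0 h))).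

Lemma lipschitz_regularize n h : lipschitz n (regularize n h).
Proof. exact/lipschitz_lip_reg/exc_ge0. Qed.

Lemma regularize_le n h t : regularize n h t <= h t.
Proof. exact/lip_reg_le_id/exc_ge0. Qed.

Lemma regularize_homo n m h t : (n <= m)%N -> regularize n h t <= regularize m h t.
Proof. exact/lip_reg_homo/exc_ge0. Qed.

Lemma regularize_regularize n m h : (n <= m)%N ->
  regularize n (regularize m h) = regularize n h.
Proof. by move=> nm; apply: excursion_eq => t; exact/lip_reg_lip_reg/nm/exc_ge0. Qed.

Lemma regularize_contraction n h g e : (forall t, `|h t - g t| <= e) ->
  forall t, `|regularize n h t - regularize n g t| <= e.
Proof. by move=> hg; apply: lip_reg_contraction => //; exact: exc_ge0. Qed.

(** An excursion need not be bounded, but it is bounded on any finite net. *)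
Lemma coarse_bound h e : 0 < e ->
  exists M, forall t, exists2 s, `|\val t - \val s| <= e & h s <= M.
Proof.
move=> e0; pose m := Num.truncn e^-1.
have me : m.+1%:R^-1 <= e.
  by rewrite invf_ple ?posrE ?ltr0n// ltW// truncnS_gt.
exists (\sum_(k < m.+2) h (grid_point m k)) => t.
have [k km tk] := grid_point_near m t; exists (grid_point m k).
  exact: le_trans me.
rewrite (bigD1 (Ordinal (km : (k < m.+2)%N)))//= lerDl sumr_ge0// => i _.
exact: exc_ge0.
Qed.

(** Let M be the bound given by coarse_bound.  A point (t, y) of the epigraph of
    the regularization with y <= M has a near-minimizer s within distance about
    M / n of t; if y > M, a point of the net replaces s. *)
Lemma regularize_cvg_Gamma h e : 0 < e ->
  exists N, forall n, (N <= n)%N -> dist_Gamma (regularize n h) h <= e.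
Proof.
move=> e0; have d0 : 0 < e / 2 by rewrite divr_gt0.
have [M hM] := coarse_bound h d0; set d := e / 2 in d0 hM.
exists (Num.truncn ((M + d) / d)).+1 => n Nn; apply: dist_Gamma_le; last first.
  move=> [x y] [t /= [-> y0 hy]]; exists (\val t, y).
    by exists t; split => //; exact: le_trans (regularize_le n h t) hy.
  by rewrite euclid_dist_vert subrr normr0 ltW.
have nM : M + d < n%:R * d.
  by rewrite -ltr_pdivrMr// (lt_le_trans (truncnS_gt _))// ler_nat.
move=> [x y] [t /= [-> y0 hy]]; have [yM|My] := leP y M.
  have [|s hs] := @lip_reg_near_inf _ n h t (y + d).
    by rewrite (le_lt_trans hy)// ltrDl.
  have hsy : h s <= y + d.
    by rewrite (le_trans _ (ltW hs))// lerDl mulr_ge0.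
  have ts : `|\val t - \val s| <= d.
    have n0 : 0 < n%:R :> R by rewrite ltr0n (leq_trans _ Nn).
    rewrite -(ler_pM2l n0) ltW// (le_lt_trans _ nM)//.
    apply: (@le_trans _ _ (y + d)); last by rewrite lerD2r.
    by rewrite (le_trans _ (ltW hs))// lerDr exc_ge0.
  exists (\val s, y + d); first by exists s; split => //=; rewrite addr_ge0// ltW.
  rewrite (le_trans (euclid_le_dist _ _))//= opprD addNKr normrN [e]splitr lerD//.
  by rewrite gtr0_norm.
have [s ts hs] := hM t; exists (\val s, y).
  by exists s; split => //=; exact: le_trans hs (ltW My).
rewrite (le_trans (euclid_le_dist _ _))//= subrr normr0 addr0 (le_trans ts)//.
by rewrite ler_pdivrMr// mulr_natr mulr2n lerDl ltW.
Qed.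

(** The sets where h exceeds its regularization by more than e are relatively
    open, so measurable, and decrease to the empty set. *)
Lemma regularize_cvg_lambda h e : 0 < e ->
  exists N, forall n, (N <= n)%N -> dist_lambda (regularize n h) h <= e.
Proof.
move=> e0.
pose A n : set R :=
  set_val @` [set t : unit_itv R | (e < `|regularize n h t - h t|)%R].
have AE n t : (e < `|regularize n h t - h t|) = (e < h t - regularize n h t).
  by rewrite ler0_norm ?opprB// subr_le0 regularize_le.
have Asub n : A n `<=` `[0, 1].
  by move=> _ [t _ <-]; have := valP t; rewrite inE.
have mA n : measurable (A n).
  have lsc : lower_semicontinuous (fun t => (h t - regularize n h t)%:E).
    apply/lower_semicontinuous_distP => t a at_.
    pose b := (h t - regularize n h t - a) / 2.
    have b0 : 0 < b by rewrite divr_gt0// subr_gt0.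
    have /lower_semicontinuous_distP lh := @exc_lsc _ h.
    have [|d d0 dP] := lh t (h t - b); first by rewrite ltrBlDr ltrDl.
    have [r r0 rP] := lipschitz_near t (lipschitz_regularize n h) b0.
    exists (Num.min d r); first by rewrite lt_min d0.
    move=> s; rewrite lt_min => /andP[/dP h1 /rP].
    by rewrite ltr_distlC => /andP[_]; rewrite /b in h1 *; lra.
  have [U oU UE] := (lower_semicontinuousP _).1 lsc e.
  have UP t : U (\val t) = (e%:E < (h t - regularize n h t)%:E)%E.
    exact: (congr1 (fun S => S t) UE).
  have -> : A n = U `&` `[0, 1].
    apply/seteqP; split=> [x [t /= et <-]|x [Ux x01]].
      split; last by have := valP t; rewrite inE.
      by rewrite UP lte_fin -AE.
    have xI : x \in unit_itv R by rewrite inE.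
    exists (exist _ x xI) => //=; rewrite AE -lte_fin.
    by rewrite -[is_true _]UP.
  apply: measurableI; last exact: measurable_itv.
  exact: measurable_realfun.open_measurable.
have A0 : \bigcap_n A n = set0.
  apply/seteqP; split=> // x Ax.
  have [t et tx] := Ax 0%N I.
  have [|N NP] := @lip_reg_cvg _ h t (h t - e) (exc_ge0 h) (@exc_lsc _ h).
    by rewrite ltrBlDr ltrDl.
  have [t' + t'x] := Ax N I.
  have -> : t' = t by apply/val_inj; rewrite [RHS]tx.
  by rewrite /= AE; have := NP N (leqnn N); rewrite /regularize /=; lra.
have Adec : {homo A : n m / (n <= m)%N >-> (m <= n)%O}.
  move=> n m nm; apply/subsetPset; apply: image_subset => t /=.
  rewrite !AE => /lt_le_trans; apply; rewrite lerD2l lerN2.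
  exact: regularize_homo.
have : (lebesgue_measure \o A) n @[n --> \oo] --> lebesgue_measure (\bigcap_n A n).
  apply: nonincreasing_cvg_mu => //; last by rewrite A0.
  apply: (@le_lt_trans _ _ (lebesgue_measure (`[0, 1] : set R))).
    exact: le_outer_measure.
  by rewrite lebesgue_measure_itv /= lte_fin ltr01 oppr0 adde0 ltry.
rewrite A0 measure0 => /(_ _ (open_ereal_lt' _)) - /(_ e%:E).
rewrite lte_fin => /(_ e0)[N _ NP].
by exists N => n Nn; apply: dist_lambda_le => //; exact: NP.
Qed.

Lemma regularize_cvg h e : 0 < e ->
  exists N, forall n, (N <= n)%N -> exc_dist (regularize n h) h <= e.
Proof.
move=> e0; have e20 : 0 < e / 2 by rewrite divr_gt0.
have [N1 P1] := regularize_cvg_Gamma h e20.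
have [N2 P2] := regularize_cvg_lambda h e20.
exists (maxn N1 N2) => n; rewrite geq_max => /andP[/P1 ? /P2 ?].
by rewrite [e]splitr lerD.
Qed.

End regularized_excursions.

(** * A finer metric on bounded excursions *)

Section bounded_excursions.
Context {R : realType}.
Implicit Types (h g u v w : excursion R) (n m : nat) (s t : unit_itv R).

Definition bounded_exc h := exists M, forall t, h t <= M.

Lemma bounded_excP h : bounded_fun (h : unit_itv R -> R) <-> bounded_exc h.
Proof.
split.
  by move=> /bounded_fun_has_ubound[M hM]; exists M => t; apply: hM; exists t.
move=> [M hM]; exists M; split; first exact: num_real.
by move=> x /ltW Mx t _ /=; rewrite ger0_norm ?exc_ge0// (le_trans (hM t)).
Qed.

Lemma bounded_regularize n h : bounded_exc (regularize n h).
Proof.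
exists n%:R => t; have := lipschitz_regularize n h unit_itv0 t.
rewrite exc_at0 add0r subr0 => /le_trans; apply.
have /andP[t0 t1] : 0 <= \val t <= 1 by have := valP t; rewrite inE /unit_itv /= in_itv.
by rewrite ger0_norm// ler_piMr.
Qed.

Definition height h := sup (range h).

Lemma le_height h t : bounded_exc h -> h t <= height h.
Proof.
by move=> [M hM]; apply: ub_le_sup; [exists M => _ [s _ <-]|exists t].
Qed.

Lemma height_le h M : (forall t, h t <= M) -> height h <= M.
Proof.
by move=> hM; apply: ge_sup => [|_ [t _ <-]//]; exists (h unit_itv0); exists unit_itv0.
Qed.

Lemma height_homo h g : bounded_exc g -> (forall t, h t <= g t) -> height h <= height g.
Proof.
by move=> bg hg; apply: height_le => t; rewrite (le_trans (hg t))// le_height.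
Qed.

Lemma height_dist_le h g e : bounded_exc h -> bounded_exc g ->
  (forall t, `|h t - g t| <= e) -> `|height h - height g| <= e.
Proof.
move=> bh bg hg; rewrite ler_distl lerBlDr; apply/andP; split; apply: height_le => t.
  have := hg t; rewrite ler_distlC => /andP[_] /le_trans; apply.
  by rewrite lerD2r le_height.
have := hg t; rewrite ler_distl => /andP[_] /le_trans; apply.
by rewrite lerD2r le_height.
Qed.

Lemma regularize_cvg_height h e : bounded_exc h -> 0 < e ->
  exists N, forall n, (N <= n)%N -> `|height (regularize n h) - height h| <= e.
Proof.
move=> bh e0.
have ne : range h !=set0 by exists (h unit_itv0); exists unit_itv0.
have hte : height h - e < sup (range h) by rewrite ltrBlDr ltrDl.
have [_ [t _ <-] ht] := sup_gt ne hte.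
have [N NP] := lip_reg_cvg (exc_ge0 h) (@exc_lsc _ h) ht.
exists N => n /NP hn; rewrite ler_distl.
rewrite (le_trans hn (le_height t (bounded_regularize n h)))/=.
rewrite (le_trans (height_homo bh (regularize_le n h)))// lerDl; exact: ltW.
Qed.

(** The height is added to the excursion metric so that a limit of bounded
    excursions stays bounded. *)
Definition height_dist h g := exc_dist h g + `|height h - height g|.

Lemma exc_dist_le_height_dist h g : exc_dist h g <= height_dist h g.
Proof. by rewrite lerDl. Qed.

Lemma height_le_height_dist h g : height h <= height g + height_dist h g.
Proof.
by rewrite -lerBlDl; apply: le_trans (ler_norm _) _; rewrite lerDr exc_dist_ge0.
Qed.

Lemma height_dist_sym h g : height_dist h g = height_dist g h.
Proof. by rewrite /height_dist exc_dist_sym distrC. Qed.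

Lemma height_dist_triangle g h k :
  height_dist h k <= height_dist h g + height_dist g k.
Proof. by rewrite addrACA lerD ?exc_dist_triangle ?ler_distD. Qed.

Lemma height_dist_le_sup h g e : bounded_exc h -> bounded_exc g ->
  (forall t, `|h t - g t| <= e) -> height_dist h g <= 3 * e.
Proof.
move=> bh bg hg; have := exc_dist_le_sup hg; have := height_dist_le bh bg hg.
by rewrite /height_dist; lra.
Qed.

Lemma height_dist_sandwich u v w : bounded_exc w ->
  (forall t, u t <= v t) -> (forall t, v t <= w t) ->
  height_dist v w <= height_dist u w.
Proof.
move=> bw uv vw; rewrite lerD ?exc_dist_sandwich//.
have bv : bounded_exc v.
  by case: bw => M wM; exists M => t; exact: le_trans (vw t) (wM t).
have uvh := height_homo bv uv; have vwh := height_homo bw vw.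
by rewrite !ler0_norm ?lerN2 ?lerD2r ?subr_le0// (le_trans uvh).
Qed.

Lemma regularize_cvg_height_dist h e : bounded_exc h -> 0 < e ->
  exists N, forall n, (N <= n)%N -> height_dist (regularize n h) h <= e.
Proof.
move=> bh e0; have e20 : 0 < e / 2 by rewrite divr_gt0.
have [N1 P1] := regularize_cvg h e20.
have [N2 P2] := regularize_cvg_height bh e20.
exists (maxn N1 N2) => n; rewrite geq_max => /andP[/P1 ? /P2 ?].
by rewrite [e]splitr lerD.
Qed.

(** Requiring the regularizations to be close at every scale n at once makes a
    Cauchy sequence regularize at a uniform rate; this is what lets the limits
    in the sequence and in n be exchanged. *)
Definition scale_dist h g :=
  sup [set height_dist (regularize n h) (regularize n g) | n in [set: nat]].

Lemma scale_dist_le h g e :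
  (forall n, height_dist (regularize n h) (regularize n g) <= e) ->
  scale_dist h g <= e.
Proof.
move=> hg; apply: ge_sup => [|_ [n _ <-]//].
by eexists; exists 0%N.
Qed.

Lemma le_scale_dist n h g : bounded_exc h -> bounded_exc g ->
  height_dist (regularize n h) (regularize n g) <= scale_dist h g.
Proof.
move=> [M hM] [M' gM]; apply: ub_le_sup; last by exists n.
have hgM t : `|h t - g t| <= Num.max M M'.
  rewrite ler_distl; apply/andP; split.
    by rewrite lerBlDr (le_trans (gM t))// -[leLHS]add0r lerD ?exc_ge0// le_max lexx orbT.
  by rewrite (le_trans (hM t))// -[leLHS]add0r lerD ?exc_ge0// le_max lexx.
exists (3 * Num.max M M') => _ [m _ <-].
apply: height_dist_le_sup; [exact: bounded_regularize..|].
exact: regularize_contraction.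
Qed.

Lemma height_dist_le_scale_dist h g : bounded_exc h -> bounded_exc g ->
  height_dist h g <= scale_dist h g.
Proof.
move=> bh bg; apply/ler_addgt0Pr => e e0.
have e20 : 0 < e / 2 by rewrite divr_gt0.
have [N1 P1] := regularize_cvg_height_dist bh e20.
have [N2 P2] := regularize_cvg_height_dist bg e20.
pose n := maxn N1 N2.
have := P1 n (leq_maxl _ _); have := P2 n (leq_maxr _ _).
rewrite (height_dist_sym _ h).
have := height_dist_triangle (regularize n h) h g.
have := height_dist_triangle (regularize n g) (regularize n h) g.
by have := le_scale_dist n bh bg; lra.
Qed.

Lemma exc_dist_le_scale_dist h g : bounded_exc h -> bounded_exc g ->
  exc_dist h g <= scale_dist h g.
Proof.
move=> bh bg; apply: le_trans (exc_dist_le_height_dist h g) _.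
exact: height_dist_le_scale_dist.
Qed.

Lemma scale_dist_sym h g : scale_dist h g = scale_dist g h.
Proof.
rewrite /scale_dist; congr sup; apply: eq_imagel => n _; exact: height_dist_sym.
Qed.

Lemma scale_dist_triangle g h k :
  bounded_exc h -> bounded_exc g -> bounded_exc k ->
  scale_dist h k <= scale_dist h g + scale_dist g k.
Proof.
move=> bh bg bk; apply: scale_dist_le => n.
rewrite (le_trans (height_dist_triangle (regularize n g) _ _))//.
by rewrite lerD ?le_scale_dist.
Qed.

Lemma scale_dist_metric : metric_axioms
  (fun x y : [set h : excursion R | bounded_fun (h : unit_itv R -> R)] =>
    scale_dist (\val x) (\val y)).
Proof.
have bP (x : [set h : excursion R | bounded_fun (h : unit_itv R -> R)]) :
    bounded_exc (\val x).
  by apply/bounded_excP; have := valP x; rewrite inE.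
split=> [x|x y xy|x y|y x z].
- apply/eqP; rewrite eq_le; apply/andP; split.
    rewrite -(mulr0 3); apply: scale_dist_le => n.
    apply: height_dist_le_sup; [exact: bounded_regularize..|].
    by move=> t; rewrite subrr normr0.
  exact: le_trans (exc_dist_ge0 _ _) (exc_dist_le_scale_dist (bP x) (bP x)).
- apply: val_inj; apply: (metric_eq0 (@exc_dist_metric R)); apply/eqP.
  by rewrite eq_le exc_dist_ge0 andbT -xy exc_dist_le_scale_dist.
- exact: scale_dist_sym.
- exact: scale_dist_triangle.
Qed.

End bounded_excursions.

(** * Completeness of the finer metric *)

Section completeness.
Context {R : realType}.
Implicit Types (s t : unit_itv R).

(** Compactness of the unit interval: the sublevel sets at y are closed,
    nonempty and decreasing.  The common point is the limit of their leftmost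
    points. *)
Lemma nested_sublevel (L : nat -> nat) (g : nat -> unit_itv R -> R) y :
  (forall m, lipschitz (L m) (g m)) ->
  (forall m k s, (m <= k)%N -> g m s <= g k s) ->
  (forall m, exists s, g m s <= y) ->
  exists s, forall m, g m s <= y.
Proof.
move=> lg hg gy.
have s01 s : 0 <= \val s <= 1 by have := valP s; rewrite inE /unit_itv /= in_itv.
pose K m : set R := [set \val s | s in [set s : unit_itv R | g m s <= y]].
have K0 m : K m !=set0 by have [s sy] := gy m; exists (\val s), s.
have Klb m x : K m x -> inf (K m) <= x.
  by apply: ge_inf; exists 0 => _ [s _ <-]; have /andP[] := s01 s.
have Kdec m k : (m <= k)%N -> inf (K m) <= inf (K k).
  move=> mk; apply: lb_le_inf => // _ [s sy <-]; apply: Klb.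
  by exists s => //=; exact: le_trans (hg m k s mk) sy.
pose A : set R := range (fun m => inf (K m)).
have A0 : A !=set0 by exists (inf (K 0%N)), 0%N.
have Aub : ubound A 1.
  move=> _ [m _ <-]; have [_ [s sy _]] := K0 m.
  apply: (@le_trans _ _ (\val s)); first by apply: Klb; exists s.
  by have /andP[] := s01 s.
have A01 : 0 <= sup A <= 1.
  rewrite ge_sup// andbT; apply: (@le_trans _ _ (inf (K 0%N))).
    by apply: lb_le_inf => // _ [s _ <-]; have /andP[] := s01 s.
  by apply: ub_le_sup; [exists 1|exists 0%N].
have AI : sup A \in unit_itv R by rewrite inE /unit_itv /= in_itv.
exists (exist _ (sup A) AI) => k; apply/ler_addgt0Pr => e e0.
have [d d0 dP] := lipschitz_near (exist _ (sup A) AI) (lg k) e0.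
have [|_ [m _ <-] Am] := sup_gt A0 (_ : sup A - d < sup A).
  by rewrite ltrBlDr ltrDl.
pose j := maxn m k.
have [|_ [s sy <-] sj] := inf_lt (K0 j) (_ : inf (K j) < inf (K j) + d).
  by rewrite ltrDl.
have Kjs : inf (K j) <= \val s by apply: Klb; exists s.
have KjA : inf (K j) <= sup A by apply: ub_le_sup; [exists 1|exists j].
have mj := Kdec m j (leq_maxl _ _).
have /dP : `|sup A - \val s| < d by rewrite ltr_norml; apply/andP; split; lra.
rewrite ltr_distl => /andP[_ /ltW/le_trans]; apply; rewrite lerD2r.
exact: le_trans (hg k j s (leq_maxr _ _)) sy.
Qed.

(** Regularization commutes with increasing limits: near-minimizers for all the
    g m at once exist by compactness. *)
Lemma lip_reg_le_monotone_limit n (g : nat -> unit_itv R -> R) (f : unit_itv R -> R) t y :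
  (forall s, 0 <= f s) ->
  (forall m, lipschitz m (g m)) ->
  (forall m k s, (m <= k)%N -> g m s <= g k s) ->
  (forall s z, (forall m, g m s <= z) -> f s <= z) ->
  (forall m, lip_reg n (g m) t < y) -> lip_reg n f t <= y.
Proof.
move=> f0 lg hg fg gy.
have [m s r|m k s mk|m|s sy] := @nested_sublevel (fun m => m + n)%N
    (fun m s => g m s + n%:R * `|\val t - \val s|) y.
- have := lg m s r; have : n%:R * `|\val t - \val r| <=
      n%:R * `|\val t - \val s| + n%:R * `|\val r - \val s|.
    by rewrite -mulrDr ler_wpM2l// (distrC (\val r)) ler_distD.
  by rewrite natrD mulrDl; lra.
- by rewrite lerD2r hg.
- by have [s /ltW] := lip_reg_near_inf (gy m); exists s.
rewrite (le_trans (lip_reg_le n s t f0))// -lerBrDr.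
by apply: fg => m; rewrite lerBrDr sy.
Qed.

Section limit.
Variables (x : nat -> excursion R) (e : nat -> R).
Hypothesis bx : forall k, bounded_exc (x k).
Hypothesis e_ge0 : forall k, 0 <= e k.
Hypothesis e_small : forall d, 0 < d -> exists k, e k < d.
Hypothesis x_dist : forall k l, scale_dist (x k) (x l) <= e k + e l.

Let vanish (a b C : R) : 0 <= C -> (forall k, a <= b + C * e k) -> a <= b.
Proof.
move=> C0 ab; apply/ler_addgt0Pr => d d0; have C1 : 0 < C + 1 by rewrite ltr_wpDl.
have [k] := e_small (divr_gt0 d0 C1); rewrite ltr_pdivlMr// => ek.
by rewrite (le_trans (ab k))// lerD2l; have := e_ge0 k; nra.
Qed.

(* the constant of lipschitz_dist_Gamma *)
Let C n : R := 1 + n%:R.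

Let C_ge0 n : 0 <= C n. Proof. by rewrite addr_ge0. Qed.

(** The limit in k of the n-regularizations, as the supremum of lower bounds
    with the explicit error C n * e k. *)
Let scale_limit n t : R := sup (range (fun k => regularize n (x k) t - C n * e k)).

Let regularize_dist n k l t :
  regularize n (x k) t - C n * e k <= regularize n (x l) t + C n * e l.
Proof.
have := lipschitz_dist_Gamma t
  (lipschitz_regularize n (x k)) (lipschitz_regularize n (x l)).
rewrite ler_distl => /andP[_ /le_trans h]; rewrite lerBlDr h// -addrA lerD2l -mulrDr.
rewrite ler_wpM2l ?C_ge0// (le_trans (dist_Gamma_le_exc _ _))//.
rewrite (le_trans (exc_dist_le_height_dist _ _))//.
by rewrite (le_trans (le_scale_dist n (bx k) (bx l)))// addrC.
Qed.

Let scale_limit_dist n k t :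
  `|regularize n (x k) t - scale_limit n t| <= C n * e k.
Proof.
have ub k' : ubound (range (fun k => regularize n (x k) t - C n * e k))
    (regularize n (x k') t + C n * e k').
  by move=> _ [l _ <-]; exact: regularize_dist.
rewrite ler_distlC lerBlDr; apply/andP; split.
  rewrite -lerBlDr; apply: ub_le_sup; last by exists k.
  by eexists; exact: (ub 0%N).
apply: ge_sup; last exact: ub.
by eexists; exists 0%N.
Qed.

Let scale_limit_le n k t : scale_limit n t <= regularize n (x k) t + C n * e k.
Proof. by have := scale_limit_dist n k t; rewrite ler_distlC => /andP[]. Qed.

Let le_scale_limit n k t : regularize n (x k) t <= scale_limit n t + C n * e k.
Proof. by have := scale_limit_dist n k t; rewrite ler_distl => /andP[]. Qed.

Let scale_limit_ge0 n t : 0 <= scale_limit n t.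
Proof.
apply: (vanish (C_ge0 n)) => k; exact: le_trans (exc_ge0 _ t) (le_scale_limit n k t).
Qed.

Let scale_limit_lipschitz n : lipschitz n (scale_limit n).
Proof.
move=> s t; apply: (@vanish _ _ (2 * C n)); first by rewrite mulr_ge0.
move=> k; have := scale_limit_le n k t; have := le_scale_limit n k s.
by have := lipschitz_regularize n (x k) s t; lra.
Qed.

Let scale_limit_homo n m t : (n <= m)%N -> scale_limit n t <= scale_limit m t.
Proof.
move=> nm; apply: (@vanish _ _ (C n + C m)); first by rewrite addr_ge0.
move=> k; have := scale_limit_le n k t; have := le_scale_limit m k t.
by have := regularize_homo (x k) t nm; lra.
Qed.

Let lip_reg_scale_limit n m t : (n <= m)%N ->
  lip_reg n (scale_limit m) t = scale_limit n t.
Proof.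
move=> nm.
have close k : `|lip_reg n (scale_limit m) t - scale_limit n t| <= 0 + (C m + C n) * e k.
  rewrite add0r mulrDl (le_trans (ler_distD (regularize n (x k) t) _ _))// lerD//.
  rewrite -(regularize_regularize (x k) nm).
  apply: lip_reg_contraction => // [s|s]; first exact: exc_ge0.
  by rewrite distrC; exact: scale_limit_dist.
have := vanish (addr_ge0 (C_ge0 m) (C_ge0 n)) close.
by rewrite normr_le0 subr_eq0 => /eqP.
Qed.

Let bound := height (x 0%N) + 2 * e 0%N.

Let scale_limit_le_bound n t : scale_limit n t <= bound.
Proof.
apply: (@vanish _ _ (C n + 1)); first by rewrite addr_ge0.
move=> k; have := scale_limit_le n k t.
have := regularize_le n (x k) t; have := le_height t (bx k).
have := height_le_height_dist (x k) (x 0%N).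
have := height_dist_le_scale_dist (bx k) (bx 0%N); have := x_dist k 0%N.
by have := e_ge0 0%N; rewrite /bound; lra.
Qed.

Let lim t : R := sup (range (fun n => scale_limit n t)).

Let scale_limit_le_lim n t : scale_limit n t <= lim t.
Proof.
by apply: ub_le_sup; [exists bound => _ [m _ <-]; exact: scale_limit_le_bound|exists n].
Qed.

Let lim_le t z : (forall n, scale_limit n t <= z) -> lim t <= z.
Proof.
by move=> tz; apply: ge_sup => [|_ [n _ <-]//]; eexists; exists 0%N.
Qed.

Let lim_ge0 t : 0 <= lim t.
Proof. exact: le_trans (scale_limit_ge0 0 t) (scale_limit_le_lim 0 t). Qed.

Let lim_at0 : lim unit_itv0 = 0.
Proof.
apply/eqP; rewrite eq_le lim_ge0 andbT; apply: lim_le => n.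
by apply: (vanish (C_ge0 n)) => k; have := scale_limit_le n k unit_itv0; rewrite exc_at0.
Qed.

Let lim_lsc : lower_semicontinuous (fun t => (lim t)%:E).
Proof.
apply/lower_semicontinuous_distP => t a at_.
have ne : range (fun n => scale_limit n t) !=set0 by eexists; exists 0%N.
have [_ [n _ <-] an] := sup_gt ne at_.
have /lower_semicontinuous_distP/(_ t a an)[d d0 dP] :=
  lipschitz_lower_semicontinuous (@scale_limit_lipschitz n).
exists d => [|s /dP as_]; first exact: d0.
exact: lt_le_trans as_ (scale_limit_le_lim n s).
Qed.

Let limit_excursion := Excursion lim_ge0 lim_at0 lim_lsc.

Let regularize_limit n t : regularize n limit_excursion t = scale_limit n t.
Proof.
apply/eqP; rewrite eq_le; apply/andP; split; last exact: lip_reg_maximal.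
apply/ler_addgt0Pr => d d0.
apply: (@lip_reg_le_monotone_limit n scale_limit) => // m.
rewrite (@le_lt_trans _ _ (lip_reg n (scale_limit (maxn n m)) t))//.
  rewrite -[leRHS]addr0; apply: lip_reg_le_dist => // s.
  by rewrite addr0 scale_limit_homo// leq_maxr.
by rewrite lip_reg_scale_limit ?leq_maxl// ltrDl.
Qed.

(** The bound between x k and x l holds at every scale with the same right-hand
    side, so letting l tend to infinity at each scale separately suffices. *)
Lemma scale_dist_cauchy_limit :
  exists2 f, bounded_exc f & forall k, scale_dist (x k) f <= e k.
Proof.
have bf : bounded_exc limit_excursion.
  by exists bound => t; apply: lim_le => n; exact: scale_limit_le_bound.
exists limit_excursion => // k; apply: scale_dist_le => n.
apply: (@vanish _ _ (1 + 3 * C n)); first by rewrite addr_ge0// mulr_ge0.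
move=> l; rewrite (le_trans (height_dist_triangle (regularize n (x l)) _ _))//.
have := le_scale_dist n (bx k) (bx l); have := x_dist k l.
have : height_dist (regularize n (x l)) (regularize n limit_excursion) <= 3 * (C n * e l).
  apply: height_dist_le_sup; [exact: bounded_regularize..|].
  by move=> t; rewrite regularize_limit.
by lra.
Qed.

End limit.

(** The Polish space that maps onto the bounded excursions: the same points, with
    the finer metric scale_dist. *)
Definition bounded_excursion : Type := metric_space (@scale_dist_metric R).

HB.instance Definition _ :=
  Metric.copy bounded_excursion (metric_space (@scale_dist_metric R)).

Let zero_excursion : excursion R :=
  @Excursion R (fun=> 0) (fun=> lexx 0) erefl
    (lipschitz_lower_semicontinuous (fun s t =>
       (ler_wpDr (mulr_ge0 (ler0n R 0) (normr_ge0 (\val t - \val s))) (lexx 0)))).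

Let zero_bounded : zero_excursion \in
  [set h : excursion R | bounded_fun (h : unit_itv R -> R)].
Proof. by rewrite inE; apply/bounded_excP; exists 0 => t. Qed.

HB.instance Definition _ := isPointed.Build bounded_excursion
  (exist _ zero_excursion zero_bounded).

Lemma bounded_excursionP (h : bounded_excursion) : bounded_exc (\val h).
Proof. by apply/bounded_excP; have := valP h; rewrite inE. Qed.

Lemma ball_bounded_excursion (x y : bounded_excursion) (d : R) :
  ball x d y = (scale_dist (\val x) (\val y) < d).
Proof. by rewrite ballEmdist. Qed.

Lemma bounded_excursion_complete (F : set_system bounded_excursion) :
  ProperFilter F -> cauchy F -> cvg F.
Proof.
move=> PF /cauchyP cF; pose e k : R := k.+1%:R^-1.
have e0 k : 0 < e k by rewrite invr_gt0 ltr0n.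
have small d : 0 < d -> exists k, e k < d.
  move=> d0; exists (Num.truncn d^-1); rewrite invf_plt ?posrE ?ltr0n//.
  exact: truncnS_gt.
have /choice[x xP] k : exists x, F (ball x (e k)) by exact: cF.
have xx k l : scale_dist (\val (x k)) (\val (x l)) <= e k + e l.
  have [z []] := filter_ex (filterI (xP k) (xP l)).
  rewrite !ball_bounded_excursion => /ltW xz; rewrite scale_dist_sym => /ltW zx.
  apply: le_trans (scale_dist_triangle _ (bounded_excursionP z) _) (lerD xz zx);
    exact: bounded_excursionP.
have [f bf xf] := scale_dist_cauchy_limit (fun k => bounded_excursionP (x k))
  (fun k => ltW (e0 k)) small xx.
have fI : f \in [set h : excursion R | bounded_fun (h : unit_itv R -> R)].
  by rewrite inE; apply/bounded_excP.
apply/cvg_ex; exists (exist _ f fI : bounded_excursion) => V /nbhs_ballP[d /= d0 dV].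
have [|k kd] := small (d / 2); first by rewrite divr_gt0.
apply: filterS (xP k) => y; rewrite ball_bounded_excursion => xy; apply: dV.
rewrite ball_bounded_excursion.
apply: le_lt_trans
  (scale_dist_triangle bf (bounded_excursionP (x k)) (bounded_excursionP y)) _.
rewrite [d]splitr ltrD//; last exact: lt_trans xy kd.
by rewrite scale_dist_sym (le_lt_trans (xf k)).
Qed.

HB.instance Definition _ := Uniform_isComplete.Build bounded_excursion
  bounded_excursion_complete.

End completeness.

(** * Separability and conclusion *)

(** Points with the same code are close, so one representative of each code, for
    every precision, suffices. *)
Lemma separable_countable_code (R : realType) (X : metricType R)
    (C : countType) (x0 : X) :
  (forall e : R, 0 < e -> exists code : X -> C,
    forall x y, code x = code y -> mdist x y <= e) ->
  separable X.
Proof.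
move=> cX.
have /choice[code codeP] (j : nat) : exists code : X -> C,
    forall x y, code x = code y -> mdist x y <= j.+1%:R^-1 :> R.
  by apply: cX; rewrite invr_gt0 ltr0n.
pose pick (p : nat * C) : X := xget x0 [set x | code p.1 x = p.2].
exists (range pick); first exact: sub_countable (card_image_le _ _) (countableP _).
move=> U [x Ux] oU.
have /nbhs_ballP[d /= d0 dU] : nbhs x U by apply: open_nbhs_nbhs.
pose j := Num.truncn d^-1.
have jd : j.+1%:R^-1 < d by rewrite invf_plt ?posrE ?ltr0n// truncnS_gt.
exists (pick (j, code j x)); split; last by exists (j, code j x).
apply: dU; rewrite ballEmdist /= (le_lt_trans _ jd)// codeP//.
by symmetry; apply: (@xgetPex _ x0 [set y | code j y = code j x]); exists x.
Qed.

Lemma separable_dense_image (X Y : topologicalType) (f : Y -> X) :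
  continuous f -> dense (range f) -> separable Y -> separable X.
Proof.
move=> cf df [S cS dS]; exists (f @` S).
  exact: sub_countable (card_image_le _ _) cS.
move=> U U0 oU; have [x [Ux [y _ yE]]] := df U U0 oU.
have [||z [Uz Sz]] := dS (f @^-1` U).
- by exists y; rewrite /preimage /= yE.
- by move: oU; apply: (continuousP f).1.
- by exists (f z); split => //; exists z.
Qed.

Section separability.
Context {R : realType}.
Implicit Types (h g : excursion R) (n m : nat) (t : unit_itv R).

Lemma truncn_eq_dist (x y a : R) : 0 < a -> 0 <= x -> 0 <= y ->
  Num.truncn (x / a) = Num.truncn (y / a) -> `|x - y| <= a.
Proof.
move=> a0 x0 y0 xy.
have := truncn_itv (divr_ge0 x0 (ltW a0)); have := truncn_itv (divr_ge0 y0 (ltW a0)).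
rewrite xy -natr1 !ler_pdivlMr// !ltr_pdivrMr// => /andP[? ?] /andP[? ?].
by rewrite ler_norml; apply/andP; split; lra.
Qed.

Definition grid_code n (a : R) (u : unit_itv R -> R) : seq nat :=
  let m := Num.truncn (n%:R / a) in
  [seq Num.truncn (u (grid_point m k) / a) | k <- iota 0 m.+2].

(** The mesh is at most a / n, so that an n-Lipschitz function varies by at most
    a between a point and a nearby node. *)
Lemma grid_code_close n a (u v : unit_itv R -> R) : 0 < a ->
  (forall t, 0 <= u t) -> (forall t, 0 <= v t) -> lipschitz n u -> lipschitz n v ->
  grid_code n a u = grid_code n a v -> forall t, `|u t - v t| <= 3 * a.
Proof.
move=> a0 u0 v0 lu lv uv t; set m := Num.truncn (n%:R / a).
have [k km tk] := grid_point_near m t; set s := grid_point m k in tk.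
have : `|u s - v s| <= a.
  apply: truncn_eq_dist => //; have := congr1 (fun c => nth 0%N c k) uv.
  by rewrite !(nth_map 0%N) ?size_iota ?ltnS// !nth_iota ?ltnS.
have tsa : n%:R * `|\val t - \val s| <= a.
  apply: le_trans (ler_wpM2l (ler0n _ n) tk) _.
  by rewrite ler_pdivrMr ?ltr0n// mulrC -ler_pdivrMr// ltW// truncnS_gt.
have := lu s t; have := lu t s; have := lv s t; have := lv t s.
rewrite (distrC (\val s)) !ler_norml => ? ? ? ? /andP[? ?].
by apply/andP; split; lra.
Qed.

(** From scale n on, both excursions stay within the regularization error at n;
    below scale n, regularizing again does not increase the uniform distance. *)
Lemma scale_dist_le_regularize h g n a b :
  bounded_exc h -> bounded_exc g ->
  height_dist (regularize n h) h <= a -> height_dist (regularize n g) g <= a ->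
  (forall t, `|regularize n h t - regularize n g t| <= b) ->
  scale_dist h g <= 4 * a + 3 * b.
Proof.
move=> bh bg ha ga hg.
have a0 : 0 <= a.
  by rewrite (le_trans (exc_dist_ge0 _ _) (le_trans (exc_dist_le_height_dist _ _) ha)).
have ngb := height_dist_le_sup (bounded_regularize n h) (bounded_regularize n g) hg.
apply: scale_dist_le => m; have [mn|nm] := leqP m n.
  apply: (@le_trans _ _ (3 * b)); last by rewrite lerDr mulr_ge0.
  apply: height_dist_le_sup; [exact: bounded_regularize..|] => t.
  rewrite -(regularize_regularize h mn) -(regularize_regularize g mn).
  exact: regularize_contraction.
have mh : height_dist (regularize m h) h <= a.
  apply: le_trans ha; apply: height_dist_sandwich => // t.
    exact/regularize_homo/ltnW.
  exact: regularize_le.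
have mg : height_dist (regularize m g) g <= a.
  apply: le_trans ga; apply: height_dist_sandwich => // t.
    exact/regularize_homo/ltnW.
  exact: regularize_le.
have := height_dist_triangle h (regularize m h) (regularize m g).
have := height_dist_triangle g h (regularize m g).
have := height_dist_triangle (regularize n h) h g.
have := height_dist_triangle (regularize n g) (regularize n h) g.
rewrite (height_dist_sym h (regularize n h)) (height_dist_sym g (regularize m g)).
lra.
Qed.

(** An excursion is coded by a scale n at which its regularization is close to
    it, and the rounded values of that regularization on a grid. *)
Lemma separable_bounded_excursion : separable (@bounded_excursion R).
Proof.
apply: (@separable_countable_code R _ (nat * seq nat)%type point) => e e0.
(* scale_dist_le_regularize with b = 3 a gives 4 a + 9 a = e *)
pose a := e / 13; have a0 : 0 < a by rewrite divr_gt0.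
have /choice[scale scaleP] (x : @bounded_excursion R) :
    exists n, height_dist (regularize n (\val x)) (\val x) <= a.
  have [N NP] := regularize_cvg_height_dist (bounded_excursionP x) a0.
  by exists N; exact: NP.
exists (fun x => (scale x, grid_code (scale x) a (regularize (scale x) (\val x)))).
move=> x y xy; have nE : scale x = scale y := congr1 fst xy.
have cE : grid_code (scale x) a (regularize (scale x) (\val x)) =
    grid_code (scale y) a (regularize (scale y) (\val y)) := congr1 snd xy.
have -> : e = 4 * a + 3 * (3 * a) by rewrite /a; field.
have ya := scaleP y; rewrite -nE in ya cE.
apply: (scale_dist_le_regularize (bounded_excursionP x) (bounded_excursionP y)
  (scaleP x) ya).
apply: grid_code_close a0 (exc_ge0 _) (exc_ge0 _) _ _ cE; exact: lipschitz_regularize.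
Qed.

End separability.

Theorem proposition4p5 (R : realType) :
  exists hd : metric_axioms (@exc_dist R),
    let E := metric_space hd in
    [/\ separable E,
        dense ([set h : excursion R | continuous (h : unit_itv R -> R)] : set E)
      & lusin ([set h : excursion R | bounded_fun (h : unit_itv R -> R)] : set E)].
Proof.
exists (@exc_dist_metric R) => E.
have dense_E (D : set E) :
    (forall (h : excursion R) n, D (regularize n h : E)) -> dense D.
  move=> DP U [h Uh] oU.
  have /nbhs_ballP[d /= d0 dU] : nbhs h U by apply: open_nbhs_nbhs.
  have [|N NP] := @regularize_cvg R h (d / 2); first by rewrite divr_gt0.
  exists (regularize N h : E); split; last exact: DP.
  apply: dU; rewrite ballEmdist /=.
  have := NP N (leqnn N); rewrite exc_dist_sym => /le_lt_trans; apply.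
  by rewrite ltr_pdivrMr// ltr_pMr// ltr1n.
have to_E (x y : @bounded_excursion R) d : ball x d y ->
    exc_dist (\val x) (\val y) < d.
  rewrite ball_bounded_excursion; apply: le_lt_trans.
  by apply: exc_dist_le_scale_dist; exact: bounded_excursionP.
split.
- apply: (@separable_dense_image E (@bounded_excursion R) (fun x => \val x)).
  + move=> x V /nbhs_ballP[d /= d0 dV]; apply/nbhs_ballP; exists d => //= y xy.
    by apply: dV; rewrite ballEmdist; exact: to_E.
  + apply: dense_E => h n.
    have hI : regularize n h \in [set h : excursion R | bounded_fun (h : unit_itv R -> R)].
      by rewrite inE; apply/bounded_excP; exact: bounded_regularize.
    by exists (exist _ (regularize n h) hI).
  + exact: separable_bounded_excursion.
- apply: dense_E => h n; exact: lipschitz_continuous (lipschitz_regularize n h).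
- exists (@bounded_excursion R); split; first exact: separable_bounded_excursion.
  exists id.
  + move=> x V /nbhs_ballP[d /= d0 dV]; apply/nbhs_ballP; exists d => //= y xy.
    by apply: dV; rewrite ballEmdist; exact: to_E.
  + by exists id.
Qed.
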